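(* Let $m\ge1$, $n\ge1$ and $1\le\ell\le n$. The number $r_{e,\ell}(\mathcal{C}_{n,[m]})$ of regions of level $\ell$ of the $m$-Catalan arrangement $\mathcal{C}_{n,[m]}$ contained in $\{x_1>x_2>\dots>x_n\}$ is \[r_{e,\ell}(\mathcal{C}_{n,[m]})=\frac{m\ell}{(m+1)n-\ell}\binom{(m+1)n-\ell}{mn},\] and the total number of regions of level $\ell$ is $r_\ell(\mathcal{C}_{n,[m]})=n!\,r_{e,\ell}(\mathcal{C}_{n,[m]})$.
   Context: The $m$-Catalan arrangement $\mathcal{C}_{n,[m]}$ is the arrangement in $\mathbb{R}^n$ of hyperplanes $x_i-x_j=0$ ($i<j$) and $x_i-x_j=k$ ($i\ne j$, $1\le k\le m$); for $n=1$ it is empty with unique region $\mathbb{R}$. Regions are connected components of the complement. The level of $X\subseteq\mathbb{R}^n$ is the smallest integer $\ell\ge0$ such that there are a linear subspace $W$ of dimension $\ell$ and $r>0$ with $X\subseteq\{\bm x:\min_{\bm y\in W}\|\bm x-\bm y\|\le r\}$. *)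

(* Defs.v *)
From HB Require Import structures.
From mathcomp Require Import all_boot all_order all_algebra.
From mathcomp Require Import all_classical all_reals all_analysis.


Unset Printing Implicit Defensive.
Import Order.TTheory GRing.Theory Num.Theory.
Import numFieldTopology.Exports numFieldNormedType.Exports.
Local Open Scope classical_set_scope.
Local Open Scope ring_scope.

Definition coord (R : realType) (n : nat) (x : 'rV[R]_n) (i : 'I_n) : R := x ord0 i.

(* Complement of the m-Catalan arrangement C_{n,[m]}: hyperplanes
   x_i - x_j = 0 (i<j) and x_i - x_j = k (i <> j, 1 <= k <= m).
   (k = 0 with i <> j covers the hyperplanes x_i = x_j.) *)
Definition catalan_complement (R : realType) (n m : nat) : set 'rV[R]_n :=
  [set x | forall (i j : 'I_n), i != j -> forall k : nat, (k <= m)%N ->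
     coord R n x i - coord R n x j != k%:R].

Definition catalan_regions (R : realType) (n m : nat) : set (set 'rV[R]_n) :=
  [set C | exists2 x, catalan_complement R n m x &
     C = connected_component (catalan_complement R n m) x].

Definition sqdist (R : realType) (n : nat) (x y : 'rV[R]_n) : R :=
  \sum_(i < n) (coord R n x i - coord R n y i) ^+ 2.

(* X lies within Euclidean distance r of a linear subspace of dimension l.
   A linear subspace W of dimension l is the row space of a matrix B with rank l;
   "min_{y in W} ||x - y|| <= r" is "exists y in W, ||x - y|| <= r" (min attained). *)
Definition near_subspace (R : realType) (n : nat) (X : set 'rV[R]_n) (l : nat) : Prop :=
  exists (B : 'M[R]_n) (r : R), \rank B = l /\ 0 < r /\
    forall x, X x -> exists y : 'rV[R]_n, (y <= B)%MS /\ sqdist R n x y <= r ^+ 2.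

Definition has_level (R : realType) (n : nat) (X : set 'rV[R]_n) (l : nat) : Prop :=
  near_subspace R n X l /\ forall k, near_subspace R n X k -> (l <= k)%N.

Definition dominant_chamber (R : realType) (n : nat) : set 'rV[R]_n :=
  [set x | forall i j : 'I_n, (i < j)%N -> coord R n x j < coord R n x i].

Definition regions_of_level (R : realType) (n m l : nat) : set (set 'rV[R]_n) :=
  [set C | catalan_regions R n m C /\ has_level R n C l].

Definition dominant_regions_of_level (R : realType) (n m l : nat) : set (set 'rV[R]_n) :=
  [set C | regions_of_level R n m l C /\ C `<=` dominant_chamber R n].

(* Main.v *)
Require Import Defs.
From HB Require Import structures.
From mathcomp Require Import all_boot all_order all_algebra.
From mathcomp Require Import all_classical all_reals all_analysis.
From mathcomp Require Import perm zify ring lra.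
Import Order.TTheory GRing.Theory Num.Theory.
Import numFieldTopology.Exports numFieldNormedType.Exports.
Local Open Scope classical_set_scope.
Local Open Scope ring_scope.
Local Open Scope card_scope.

(* A point x with x_1 > ... > x_n is encoded by the integers c_i counting the
   pairs (j, k), j < i and 1 <= k <= m, with x_j - k > x_i. Its region fixes,
   and is fixed by, the relative order of the points x_j - k, and this order can
   be rebuilt from the c_i by inserting x_1, x_2, ... in turn: hence the dominant
   regions correspond to the sequences 0 = c_1 <= ... <= c_n with
   c_i <= m (i - 1), i.e. to m-Dyck paths. One has c_i = m (i - 1) iff i = 1 or
   x_(i-1) - x_i > m, that is iff coordinates i, i + 1, ..., n can be pushed to
   -oo together without leaving the region; the region is within bounded
   distance of the span of these directions, so its level is the number of such
   i, the number of returns of the path. Paths with l returns are counted by the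
   Raney numbers, the coefficients of F^(m l) where F = 1 + z F^(m+1). *)

Set Implicit Arguments.
Unset Strict Implicit.

(** * Counting m-Dyck paths by returns *)

(** This is the coefficient of z^k in F^r, where F = 1 + z F^(m+1): summing F^(i+1) - F^i = z
    F^(i+1+m) over i < r gives the recursion. *)
Fixpoint raney (m k r : nat) : nat :=
  if k is k'.+1 then (\sum_(i < r) raney m k' (i.+1 + m))%N else 1%N.

Lemma raneyS (m k r : nat) :
  raney m k.+1 r.+1 = (raney m k.+1 r + raney m k (r.+1 + m))%N.
Proof. by rewrite /= big_ord_recr. Qed.

(** A form of the Raney number without division or subtraction, chosen because Pascal's rule, used
    at k and at k + 1, carries it through the recursion [raneyS]. *)
Lemma raney_binS (m k r : nat) :
  (raney m k.+1 r + m.+1 * 'C(m.+1 * k + m + r, k) =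
   'C(m.+1 * k + m + r.+1, k.+1))%N.
Proof.
elim: k r => [|k IHk] r.
  by rewrite /= sum1_card card_ord bin0 bin1; lia.
elim: r => [|r IHr].
  have := mul_bin_diag (m.+1 * k.+1 + m).+1 k.+1.
  rewrite /= big_ord0 addn0 addn1 /=; nia.
pose X := (m.+1 * k.+1 + m + r)%N.
have := IHk (r.+1 + m)%N.
have -> : (m.+1 * k + m + (r.+1 + m) = X)%N by rewrite /X; lia.
have -> : (m.+1 * k + m + (r.+1 + m).+1 = X.+1)%N by rewrite /X; lia.
move: IHr; rewrite raneyS -/X.
have -> : (m.+1 * k.+1 + m + r.+1 = X.+1)%N by rewrite /X; lia.
have -> : (m.+1 * k.+1 + m + r.+2 = X.+2)%N by rewrite /X; lia.
by rewrite (binS X.+1) (binS X k); lia.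
Qed.

Lemma raney_formula (m k r : nat) :
  (raney m k r * (m.+1 * k + r) = r * 'C(m.+1 * k + r, k))%N.
Proof.
case: k => [|k]; first by rewrite /= bin0; lia.
have := raney_binS m k r; have := mul_bin_diag (m.+1 * k + m + r).+1 k.
have -> : (m.+1 * k.+1 + r = (m.+1 * k + m + r).+1)%N by lia.
rewrite /= addnS; nia.
Qed.

(** The recursion runs over suffixes: i is the position, counted from 0, of the next entry and a is
    the entry before it. Complete codes of length n are [codes m n 0 0]. *)
Fixpoint codes (m k i a : nat) : seq (seq nat) :=
  if k is k'.+1 then
    [seq c :: s | c <- index_iota a (m * i).+1, s <- codes m k' i.+1 c]
  else [:: [::]].

Fixpoint touches (m i : nat) (s : seq nat) : nat :=
  if s is c :: s' then ((c == m * i)%N + touches m i.+1 s')%N else 0%N.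

Lemma codes_uniq (m k i a : nat) : uniq (codes m k i a).
Proof.
elim: k i a => //= k IH i a.
apply: allpairs_uniq_dep => [|c _|]; [exact: iota_uniq | exact: IH |].
by move=> [c s] [c' s'] _ _ /= [-> ->].
Qed.

Lemma mem_codesP (m k i a : nat) (s : seq nat) :
  reflect [/\ size s = k, path leq a s &
              forall j, (j < k)%N -> (nth 0%N s j <= m * (i + j))%N]
          (s \in codes m k i a).
Proof.
elim: k i a s => [|k IH] i a s /=.
  rewrite inE; apply: (iffP eqP) => [->|[+ _ _]]; first by split.
  by case: s.
apply: (iffP allpairsPdep) => [[c [t [+ /IH[<- pt tm] ->]]]|].
  rewrite mem_index_iota => /andP[ac cm]; split=> //=; first by rewrite ac.
  by case=> [|j] jk /=; rewrite ?addn0 // -addSnnS tm.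
case: s => [|c t] [] //= [st] /andP[ac pt] ctm.
exists c, t; split=> //.
  by rewrite mem_index_iota ac ltnS -[i]addn0 (ctm 0%N).
by apply/IH; split=> // j jk; rewrite addSnnS (ctm j.+1).
Qed.

Lemma touches_count (m i : nat) (s : seq nat) :
  touches m i s = (\sum_(j < size s) (nth 0%N s j == m * (i + j))%N)%N.
Proof.
elim: s i => [|c s IH] i /=; first by rewrite big_ord0.
rewrite big_ord_recl /= addn0 IH; congr addn.
by apply: eq_bigr => j _; rewrite /= addSnnS.
Qed.

(* With a the previous entry and h = m i - a the current height of the
   corresponding lattice path, the F^(h + m l) z^l decomposition of paths with
   l further returns to height 0 (F = 1 + z F^(m+1)) gives the right-hand
   side. *)
Lemma count_codes (m k i a l : nat) : (a <= m * i)%N ->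
  count (fun s => touches m i s == l) (codes m k i a) =
  (if (l <= k)%N then raney m (k - l) (m * i - a + m * l) else 0)%N.
Proof.
elim: k i a l => [|k IH] i a l ai /=.
  by rewrite addn0 leqn0 [(0 == l)%N]eq_sym; case: eqP.
(* Fixing the first entry c: if c is a return, it uses up one of the l returns, otherwise all l
   remain for the tail. *)
have step c : (c <= m * i)%N ->
    count (fun s => touches m i s == l) [seq c :: s | s <- codes m k i.+1 c] =
    (if (l <= k + (c == m * i)%N)%N && ((c == m * i)%N <= l)%N then
       raney m (k + (c == m * i)%N - l) (m * i - c + m + m * (l - (c == m * i)%N))
     else 0)%N.
  move=> ci; rewrite count_map /=.
  have cE : (m * i.+1 - c = m * i - c + m)%N by lia.
  have cb : (c <= m * i.+1)%N by lia.
  case: (c =P m * i)%N => [cmi|cmi]; last first.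
    rewrite (eq_count (_ : _ =1 fun s => touches m i.+1 s == l)); last first.
      by move=> s /=; have -> : (c == m * i)%N = false by apply/eqP.
    by rewrite IH // cE [nat_of_bool false]/= addn0 subn0 leq0n andbT.
  rewrite /= addn1; case: l => [|l].
    rewrite andbF (eq_count (_ : _ =1 pred0)) ?count_pred0 // => s /=.
    by rewrite cmi eqxx.
  rewrite (eq_count (_ : _ =1 fun s => touches m i.+1 s == l)); last first.
    by move=> s /=; rewrite cmi eqxx add1n eqSS.
  by rewrite IH // cE !ltnS leq0n andbT subSS subn1.
(* Induction on the height h. At h = 0 the next entry must be a return. At h + 1 the codes starting
   with a itself and those starting higher give the two terms of [raneyS]. *)
move: (erefl (m * i - a)%N); move: {2}(m * i - a)%N => h.
elim: h a ai => [|h IHh] a ai hE.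
  have {ai hE} aE : a = (m * i)%N by lia.
  rewrite /index_iota subSn ?aE // subnn /= cats0 step // eqxx subnn add0n addn1.
  case: l {step} => [|l] /=; first by rewrite muln0 big_ord0.
  by rewrite ltnS andbT subSS subn1 mulnS.
have ai' : (a.+1 <= m * i)%N by lia.
have -> : index_iota a (m * i).+1 = a :: index_iota a.+1 (m * i).+1.
  by rewrite /index_iota subSn //= subSS.
rewrite /= count_cat step // IHh //; last by lia.
have -> : (a == m * i)%N = false by lia.
rewrite !addn0 subn0 andbT /=.
have [lk|kl|->] := ltngtP l k.+1; first 1 last.
- by rewrite leqNgt ltnW.
- by rewrite ltnn subnn.
rewrite -ltnS lk subSn //.
have -> : (m * i - a + m * l = (m * i - a.+1 + m * l).+1)%N by lia.
rewrite raneyS addnC; congr (_ + raney _ _ _)%N; lia.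
Qed.

(** [count_codes] gives the Raney number with k = n - l and r = m l. Here (m+1) k + r = (m+1) n - l,
    and the symmetry of binomials turns the lower index n - l into m n. *)
Lemma size_codes_touches (m n l : nat) : (l <= n)%N ->
  (size [seq s <- codes m n 0 0 | touches m 0 s == l] * (m.+1 * n - l) =
   m * l * 'C(m.+1 * n - l, m * n))%N.
Proof.
move=> ln; rewrite size_filter count_codes // ln muln0 subn0 add0n.
have := raney_formula m (n - l) (m * l).
have -> : (m.+1 * (n - l) + m * l = m.+1 * n - l)%N by nia.
have -> : (n - l = m.+1 * n - l - m * n)%N by nia.
by rewrite bin_sub //; nia.
Qed.

(** * Codes of decreasing generic sequences *)

Lemma max_below {R : realFieldType} (s : seq R) (b : R) :
  has (fun p => p < b) s ->
  exists q, [/\ q \in s, q < b & {in s, forall p, p < b -> p <= q}].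
Proof.
elim: s => //= p s IH; have [/IH[q [qs qb qmax]] _|sb] := boolP (has _ s).
  have [pq|qp] := leP p q.
    exists q; split=> //; first by rewrite inE qs orbT.
    by move=> r; rewrite inE => /predU1P[->//|/qmax].
  have [pb|bp] := ltP p b; [exists p | exists q]; split=> //;
    rewrite ?inE ?eqxx ?qs ?orbT // => r; rewrite inE => /predU1P[->|rs] //.
  - by move/(qmax r rs)/le_trans; apply; exact: ltW.
  - by rewrite ltNge bp.
  - exact: qmax.
rewrite orbF => pb; exists p; split; rewrite ?inE ?eqxx // => r.
rewrite inE => /predU1P[->//|rs rb]; case/hasP: sb; by exists r.
Qed.

Lemma exists_below {R : realFieldType} (s : seq R) (b : R) :
  exists z, z < b /\ {in s, forall p, p < b -> p < z}.
Proof.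
have [/max_below[q [_ qb qmax]]|sb] := boolP (has (fun p => p < b) s).
  by exists ((q + b) / 2); split=> [|p ps pb]; last have := qmax p ps pb; lra.
exists (b - 1); split=> [|p ps pb]; first by lra.
by case/hasP: sb; exists p.
Qed.

(** The threshold b is lowered past one element of s at a time, each time to the largest element
    below it, until c elements are at or above it; z is then taken just below the threshold. *)
Lemma exists_rank {R : realFieldType} (s : seq R) (b : R) (c : nat) :
  uniq s -> (count (fun p => (b <= p)%R) s <= c <= size s)%N ->
  exists z, [/\ z < b, z \notin s & count (fun p => z < p) s = c].
Proof.
move=> us; move: {2}(c - _)%N (erefl (c - count (fun p => (b <= p)%R) s)%N) => d.
elim: d b => [|d IH] b dE /andP[bc cs].
  have [z [zb zP]] := exists_below s b; exists z; split=> //.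
    by apply/negP => zs; have := zP z zs zb; rewrite ltxx.
  have {dE} -> : c = count (fun p => (b <= p)%R) s by lia.
  apply: eq_in_count => p ps; apply/idP/idP => [zp|]; last exact: lt_le_trans.
  by rewrite leNgt; apply/negP => /(zP p ps); rewrite ltNge (ltW zp).
have : has (fun p => p < b) s.
  rewrite has_count -(ltn_add2l (count (fun p => (b <= p)%R) s)) addn0.
  rewrite -[X in (_ < _ + X)%N](@eq_count _ (predC (fun p => (b <= p)%R))).
    by rewrite count_predC; apply: leq_trans cs; rewrite -subn_gt0 dE.
  by move=> p /=; rewrite -ltNge.
case/max_below=> q [qs qb qmax].
have qE : count (fun p => q <= p) s = (count (fun p => (b <= p)%R) s).+1.
  have := count_predUI (fun p => (b <= p)%R) (pred1 q) s.
  rewrite (count_uniq_mem _ us) qs addn1 => <-.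
  rewrite [X in (_ + X)%N](@eq_count _ _ pred0) ?count_pred0 ?addn0; last first.
    by move=> p /=; apply/negP => /andP[bp /eqP pq]; move: qb; rewrite ltNge -pq bp.
  apply: eq_in_count => p ps /=; apply/idP/idP => [qp|/orP[bp|/eqP-> //]].
    by case: (leP b p) => //= pb; apply/eqP/le_anti; rewrite qp qmax.
  exact: le_trans (ltW qb) bp.
have [| |z [zq zs zc]] := IH q; [lia|lia|exists z; split=> //].
exact: lt_trans qb.
Qed.

(** An element of P outside Q forces Q to lie inside P, as for up-sets of a total order; P would
    then have strictly more elements than Q. *)
Lemma count_chain_eq {T : eqType} (s : seq T) (P Q : pred T) :
  count P s = count Q s ->
  {in s &, forall x y, P x -> ~~ Q x -> Q y -> P y} ->
  {in s, forall x, P x -> Q x}.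
Proof.
move=> cPQ chain x xs Px; apply: contraT => nQx.
have QP : count Q s = count (predI Q P) s.
  apply: eq_in_count => y ys /=; case Qy: (Q y) => //=.
  by rewrite (chain x y).
have := count_predC Q (seq.filter P s); rewrite size_filter cPQ !count_filter -QP.
move=> /eqP; rewrite -[X in _ == X]addn0 eqn_add2l => /eqP/eqP.
rewrite -leqn0 leqNgt -has_count => /hasP[]; by exists x => //=; rewrite nQx.
Qed.

(** Sequences are indexed by [nat] rather than by ['I_n], so that inductions on n can restrict or
    extend them without casts. *)
Definition generic {R : realFieldType} (m n : nat) (u : nat -> R) : Prop :=
  forall i j k : nat, (i < n)%N -> (j < n)%N -> i != j -> (k <= m)%N ->
    u i - u j != k%:R.

Definition decreasing {R : realFieldType} (n : nat) (u : nat -> R) : Prop :=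
  forall i j : nat, (i < j)%N -> (j < n)%N -> u j < u i.

Definition pairs (m i : nat) : seq (nat * nat) :=
  [seq (j, k) | j <- iota 0 i, k <- iota 1 m].

Definition code {R : realFieldType} (m : nat) (u : nat -> R) (i : nat) : nat :=
  count (fun p => u i < u p.1 - p.2%:R) (pairs m i).

Lemma mem_pairs (m i j k : nat) :
  ((j, k) \in pairs m i) = (j < i)%N && (0 < k <= m)%N.
Proof.
apply/allpairsP/idP => [[[a b] /= [+ + [-> ->]]]|/andP[ji km]].
  by rewrite !mem_iota => ? ?; lia.
by exists (j, k); rewrite !mem_iota; split=> //=; lia.
Qed.

Lemma pairs_uniq (m i : nat) : uniq (pairs m i).
Proof.
apply: allpairs_uniq; [exact: iota_uniq| exact: iota_uniq|].
by move=> [a b] [c d] _ _ [-> ->].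
Qed.

Lemma size_pairs (m i : nat) : size (pairs m i) = (m * i)%N.
Proof. by rewrite size_allpairs !size_iota mulnC. Qed.

Lemma decreasing_le {R : realFieldType} (n : nat) (u : nat -> R) (i j : nat) :
  decreasing n u -> (i <= j)%N -> (j < n)%N -> u j <= u i.
Proof.
move=> du; rewrite leq_eqVlt => /predU1P[-> //|ij jn].
exact/ltW/du.
Qed.

(** The order of two shifted points is thus read off from the sign tests. When the test has to be
    negated, genericity rules out equality. *)
Lemma generic_shift_ltE {R : realFieldType} (m n : nat) (u : nat -> R)
    (j j' k k' : nat) :
  generic m n u -> (j < n)%N -> (j' < n)%N -> (k <= m)%N -> (k' <= m)%N ->
  (u j - k%:R < u j' - k'%:R) =
  if (k <= k')%N then (k' - k)%:R < u j' - u j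
  else ~~ ((k - k')%:R < u j - u j').
Proof.
move=> gu jn jn' km km'; case: leqP => [kk|kk].
  by rewrite natrB //; apply/idP/idP; lra.
rewrite -leNgt le_eqVlt; have [->|jj] := eqVneq j j'.
  have -> : u j' - u j' < (k - k')%:R by rewrite subrr ltr0n; lia.
  rewrite orbT; have : (k'%:R : R) < k%:R by rewrite ltr_nat.
  by move=> h; apply/idP; lra.
have /negPf-> : u j - u j' != (k - k')%:R by apply: gu => //; lia.
by rewrite natrB ?(ltnW kk) //; apply/idP/idP; lra.
Qed.

(** Induction on prefixes: the signs among the first i entries order the points [u j - k] with j <
    i, and the code at i then tells which of them exceed [u i]. *)
Lemma code_determines_signs {R : realFieldType} (m n : nat) (u v : nat -> R) :
  generic m n u -> decreasing n u -> generic m n v -> decreasing n v ->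
  (forall i, (i < n)%N -> code m u i = code m v i) ->
  forall i j k, (i < n)%N -> (j < n)%N -> (k <= m)%N ->
    (k%:R < u i - u j) = (k%:R < v i - v j).
Proof.
move=> gu du gv dv uv.
suff H i : (i <= n)%N -> forall a b k, (a < i)%N -> (b < i)%N -> (k <= m)%N ->
    (k%:R < u a - u b) = (k%:R < v a - v b).
  by move=> i j k; exact: H.
elim: i => // i IH lt_in.
have ord j j' k k' : (j < i)%N -> (j' < i)%N -> (k <= m)%N -> (k' <= m)%N ->
    (u j - k%:R < u j' - k'%:R) = (v j - k%:R < v j' - k'%:R).
  move=> ji ji' km km'; rewrite (generic_shift_ltE gu); [|lia..].
  rewrite (generic_shift_ltE gv); [|lia..].
  by case: ifP => _; rewrite (IH (ltnW lt_in)) //; lia.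
(* The pairs lying above entry i form an up-set of the order ord, for u as for
   v; two up-sets of a total order with the same cardinality coincide. *)
have PQ j k : (j < i)%N -> (0 < k <= m)%N ->
    (u i < u j - k%:R) = (v i < v j - k%:R).
  move=> ji km; have jk : (j, k) \in pairs m i by rewrite mem_pairs ji.
  have cE := uv i lt_in.
  apply/idP/idP; [move: cE|move: (esym cE)] => /count_chain_eq H;
    apply: (H _ _ jk) => -[a b] [c d] /=;
    rewrite !mem_pairs => /andP[ai /andP[_ bm]] /andP[ci /andP[_ dm]] hP;
    rewrite -leNgt => hQ hQ'; have := le_lt_trans hQ hQ'.
  - by rewrite -ord //; exact: lt_trans.
  - by rewrite ord //; exact: lt_trans.
have new j k : (j < i)%N -> (k <= m)%N ->
    (k%:R < u j - u i) = (k%:R < v j - v i).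
  move=> ji; case: k => [_|k km]; first by rewrite !subr_gt0 du ?dv.
  by rewrite ltrBrDr addrC -ltrBrDr PQ // ltrBrDr addrC -ltrBrDr.
move=> a b k ai bi km; have [ab|ba] := ltnP a b.
  move: bi; rewrite ltnS leq_eqVlt => /predU1P[E|bi].
    by rewrite E; apply: new => //; rewrite -E.
  by apply: (IH (ltnW lt_in)) => //; exact: ltn_trans bi.
(* For b <= a both differences are at most 0, so both tests fail. *)
have an : (a < n)%N by lia.
have := decreasing_le du ba an; have := decreasing_le dv ba an.
by move=> hv hu; apply/idP/idP => h; have := ler0n R k; lra.
Qed.

Lemma code_leq {R : realFieldType} (m : nat) (u : nat -> R) (i : nat) :
  (code m u i <= m * i)%N.
Proof. by rewrite -size_pairs count_size. Qed.

Lemma code_nondecreasing {R : realFieldType} (m n : nat) (u : nat -> R)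
    (i : nat) :
  decreasing n u -> (i.+1 < n)%N -> (code m u i <= code m u i.+1)%N.
Proof.
move=> du lt_in; rewrite /code -!size_filter; apply: uniq_leq_size.
  exact/filter_uniq/pairs_uniq.
move=> [j k]; rewrite !mem_filter !mem_pairs /= => /and3P[ui ji ->].
by rewrite (lt_trans (du _ _ (ltnSn i) lt_in) ui) /= andbT ltnS ltnW.
Qed.

(** The lowest of the points [u j - k] with j <= i is [u i - m], so all of them lie above [u i.+1]
    as soon as this one does. *)
Lemma code_fullE {R : realFieldType} (m n : nat) (u : nat -> R) (i : nat) :
  (0 < m)%N -> decreasing n u -> (i.+1 < n)%N ->
  (code m u i.+1 == m * i.+1)%N = (m%:R < u i - u i.+1).
Proof.
move=> m0 du lt_in; rewrite -size_pairs -all_count; apply/allP/idP => [|mu].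
  by move=> /(_ (i, m)); rewrite mem_pairs ltnSn m0 leqnn => /(_ isT) /=; lra.
move=> [j k]; rewrite mem_pairs ltnS => /andP[ji /andP[_ km]] /=.
have := decreasing_le du ji (ltnW lt_in).
have : (k%:R : R) <= m%:R by rewrite ler_nat.
by move=> ? ?; lra.
Qed.

Lemma eq_code {R : realFieldType} (m : nat) (u v : nat -> R) (i : nat) :
  (forall j, (j <= i)%N -> u j = v j) -> code m u i = code m v i.
Proof.
move=> uv; apply: eq_in_count => -[j k]; rewrite mem_pairs => /andP[ji _] /=.
by rewrite !uv // ltnW.
Qed.

(** Entries are added one by one: the new one is placed by [exists_rank] below the last entry and
    under exactly the prescribed number of shifted points. *)
Lemma code_surjective {R : realFieldType} (m n : nat) (c : nat -> nat) :
  (forall i, (i.+1 < n)%N -> (c i <= c i.+1)%N) ->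
  (forall i, (i < n)%N -> (c i <= m * i)%N) ->
  exists u : nat -> R, [/\ generic m n u, decreasing n u &
    forall i, (i < n)%N -> code m u i = c i].
Proof.
elim: n => [|n IH] cmono cle; first by exists (fun=> 0); split.
have [i lt_in|i lt_in|u [gu du cu]] := IH; [exact/cmono/ltnW|exact/cle/ltnW|].
(* The first entry has no predecessor to be placed under, hence a separate case. *)
case: n {IH} => [|n] in cmono cle gu du cu *.
  exists (fun=> 0); split=> [i j k i1 j1|i j ij j1|i i1].
  - by move/eqP; lia.
  - by lia.
  - have -> : i = 0%N by lia.
    by have := cle 0%N isT; rewrite muln0; case: (c 0%N).
pose s := [seq u p.1 - p.2%:R | p <- pairs m n.+1].
have us : uniq s.
  rewrite map_inj_in_uniq ?pairs_uniq // => -[a b] [a' b'].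
  rewrite !mem_pairs /= => /andP[an /andP[b0 bm]] /andP[an' /andP[b0' bm']] E.
  have [aa|aa] := eqVneq a a'.
    move: E; rewrite aa => /addrI/oppr_inj/eqP; rewrite eqr_nat => /eqP->.
    by [].
  have [bb|bb] := leqP b b'.
    have /negP[] : u a' - u a != (b' - b)%:R by apply: gu; rewrite 1?eq_sym //; lia.
    by rewrite natrB //; apply/eqP; lra.
  have /negP[] : u a - u a' != (b - b')%:R by apply: gu => //; lia.
  by rewrite natrB ?(ltnW bb) //; apply/eqP; lra.
(* The shifted points at or above [u n] are among those counted by the code at n: they come from
   some j < n since k > 0, and genericity makes the inequality strict. So there are at most c n <= c
   n.+1 of them. *)
have [] := @exists_rank R s (u n) (c n.+1) us.
  rewrite size_map size_pairs cle // andbT.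
  apply: leq_trans (cmono n _) => //; rewrite -cu // /code count_map.
  rewrite -!size_filter; apply: uniq_leq_size.
    exact/filter_uniq/pairs_uniq.
  move=> [j k]; rewrite !mem_filter !mem_pairs ltnS /=.
  move=> /and3P[ujk jn /andP[k0 km]].
  have k0R : 0 < (k%:R : R) by rewrite ltr0n.
  have jn' : (j < n)%N.
    by rewrite ltn_neqAle jn andbT; apply: contraTneq ujk => ->; rewrite -ltNge; lra.
  rewrite jn' k0 km !andbT lt_neqAle ujk andbT.
  have : u j - u n != k%:R by apply: gu => //; lia.
  by move=> /eqP ujn; apply/eqP => E; apply: ujn; rewrite E subKr.
move=> z [zn zs zc]; pose v i := if (i < n.+1)%N then u i else z.
have vu i : (i < n.+1)%N -> v i = u i by rewrite /v => ->.
have vz : v n.+1 = z by rewrite /v ltnn.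
have zu i : (i < n.+1)%N -> z < u i.
  by move=> lt_in; apply: lt_le_trans zn _; apply: decreasing_le du _ _.
exists v; split.
- move=> i j k; rewrite (ltnS i) (ltnS j) (leq_eqVlt i) (leq_eqVlt j).
  move=> /predU1P[->|lt_in] /predU1P[->|lt_jn]; rewrite ?eqxx // => ij km.
  + rewrite vz vu //; have := zu j lt_jn; have := ler0n R k => h1 h2.
    by apply/eqP; lra.
  + rewrite vz vu //; have := zu i lt_in; case: k km => [|k] km h.
      by apply/eqP; lra.
    apply: contraNneq zs => E; apply/mapP; exists (i, k.+1).
      by rewrite mem_pairs lt_in.
    by rewrite /= -E; lra.
  + by rewrite !vu //; exact: gu.
- move=> i j ij; rewrite ltnS leq_eqVlt => /predU1P[E|lt_jn].
    by rewrite E in ij *; rewrite vz vu ?zu.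
  by rewrite !vu ?(ltn_trans ij) //; exact: du.
- move=> i; rewrite ltnS leq_eqVlt => /predU1P[->|lt_in].
    rewrite -zc /code count_map; apply: eq_in_count => -[j k].
    by rewrite mem_pairs => /andP[jn _] /=; rewrite vz vu.
  by rewrite -cu //; apply: eq_code => j ji; rewrite vu //; exact: leq_ltn_trans lt_in.
Qed.

(** * Regions as sign cells *)

Definition same_signs {R : realType} {n : nat} (m : nat) (x y : 'rV[R]_n) : Prop :=
  forall (i j : 'I_n) (k : nat), (k <= m)%N ->
    (k%:R < x ord0 i - x ord0 j) = (k%:R < y ord0 i - y ord0 j).

Lemma convex_comb_neq {R : realFieldType} (a b k t : R) :
  a != k -> b != k -> (k < a) = (k < b) -> 0 <= t <= 1 ->
  a + t * (b - a) != k.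
Proof.
move=> ak bk ab /andP[t0 t1]; apply/eqP => E.
have {}E : (1 - t) * (a - k) + t * (b - k) = 0 by rewrite -E; ring.
move: t0; rewrite le_eqVlt => /predU1P[tE|t0].
  by move/eqP: ak; apply; move: E; rewrite -tE; lra.
move: ab bk; case: ltgtP ak => // ka _ /esym kb bk.
  have : 0 < t * (b - k) by rewrite mulr_gt0 // subr_gt0.
  have : 0 <= (1 - t) * (a - k) by rewrite mulr_ge0 // subr_ge0 // ltW.
  lra.
have {kb bk}kb : b < k by rewrite lt_neqAle bk leNgt kb.
have : 0 < t * (k - b) by rewrite mulr_gt0 // subr_gt0.
have : 0 <= (1 - t) * (k - a) by rewrite mulr_ge0 // subr_ge0 // ltW.
lra.
Qed.

Lemma segment_catalan_complement {R : realType} {n m : nat}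
    (x y : 'rV[R]_n) (t : R) :
  catalan_complement R n m x -> catalan_complement R n m y ->
  same_signs m x y -> 0 <= t <= 1 -> catalan_complement R n m (x + t *: (y - x)).
Proof.
move=> hx hy xy t01 i j ij k km.
have := convex_comb_neq (hx i j ij k km) (hy i j ij k km) (xy i j k km) t01.
by congr (_ != _); rewrite /Defs.coord !mxE; ring.
Qed.

(** Points with equal signs are joined by a segment that avoids every hyperplane. Conversely a
    coordinate difference maps the component onto an interval that misses each k <= m, so no sign
    changes. *)
Lemma connected_component_catalan {R : realType} {n m : nat} (x : 'rV[R]_n.+1) :
  catalan_complement R n.+1 m x ->
  connected_component (catalan_complement R n.+1 m) x =
  [set y | catalan_complement R n.+1 m y /\ same_signs m x y].
Proof.
move=> hx; apply/seteqP; split=> y /=; last first.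
  move=> [hy xy].
  pose s := (fun t : R => x + t *: (y - x)) @` `[0, 1]%classic.
  apply: (@connected_component_max _ _ s x) => /=.
  - by exists 0; rewrite ?scale0r ?addr0 //= in_itv /= lexx ler01.
  - move=> z [t /= + <-]; rewrite in_itv /= => t01.
    exact: segment_catalan_complement.
  - apply: connected_continuous_connected; first exact: segment_connected.
    apply: continuous_subspaceT => t.
    by apply: cvgD; [exact: cvg_cst | apply: cvgZr_tmp; exact: cvg_id].
  - by exists 1; rewrite ?scale1r ?(addrC x) ?subrK //= in_itv /= lexx ler01.
move=> Cy; split; first exact: connected_component_sub Cy.
move=> i j k km; have [->|ij] := eqVneq i j; first by rewrite !subrr.
set C := connected_component _ x in Cy.
pose f (z : 'rV[R]_n.+1) := z ord0 i - z ord0 j.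
have Cx : C x by exact: connected_component_refl.
have fC : is_interval (f @` C).
  apply/connected_intervalP/connected_continuous_connected.
    exact: component_connected.
  apply: continuous_subspaceT => z.
  by apply: cvgB; [exact: nbhs_filter | exact: coord_continuous..].
have nk z : C z -> f z != k%:R.
  by move=> /connected_component_sub hz; exact: hz.
apply/idP/idP => kx; apply: contraT; rewrite -leNgt => ky.
- have [|||z Cz fz] := fC (f y) (f x) _ _ k%:R; [by exists y|by exists x| |].
    by rewrite ky ltW.
  by have /eqP := nk _ Cz.
- have [|||z Cz fz] := fC (f x) (f y) _ _ k%:R; [by exists x|by exists y| |].
    by rewrite ky ltW.
  by have /eqP := nk _ Cz.
Qed.

(** * Level of a dominant region *)

Definition ncoord {R : realType} {n : nat} (x : 'rV[R]_n.+1) (i : nat) : R :=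
  x ord0 (inord i).

Definition code_region (R : realType) (n m : nat) (s : seq nat) : set 'rV[R]_n.+1 :=
  [set x | [/\ catalan_complement R n.+1 m x, dominant_chamber R n.+1 x &
               mkseq (code m (ncoord x)) n.+1 = s]].
Arguments code_region : clear implicits.

Lemma ncoord_ord {R : realType} {n : nat} (x : 'rV[R]_n.+1) (i : 'I_n.+1) :
  ncoord x i = x ord0 i.
Proof. by rewrite /ncoord inord_val. Qed.

Lemma generic_ncoord {R : realType} {n m : nat} (x : 'rV[R]_n.+1) :
  generic m n.+1 (ncoord x) <-> catalan_complement R n.+1 m x.
Proof.
split=> [gx i j ij k km|hx i j k lt_in lt_jn ij km].
  by rewrite /Defs.coord -!ncoord_ord; apply: gx => //; exact: ltn_ord.
apply: hx => //; apply: contra ij => /eqP/(congr1 (@nat_of_ord _)).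
by rewrite !inordK // => /eqP.
Qed.

Lemma decreasing_ncoord {R : realType} {n : nat} (x : 'rV[R]_n.+1) :
  decreasing n.+1 (ncoord x) <-> dominant_chamber R n.+1 x.
Proof.
split=> [dx i j ij|dx i j ij lt_jn].
  by rewrite /Defs.coord -!ncoord_ord; apply: dx.
by apply: dx; rewrite !inordK // (ltn_trans ij).
Qed.

Lemma same_signs_code {R : realType} {n m : nat} (x y : 'rV[R]_n.+1) :
  same_signs m x y ->
  forall i, (i < n.+1)%N -> code m (ncoord x) i = code m (ncoord y) i.
Proof.
move=> xy i lt_in; apply: eq_in_count => -[j k].
rewrite mem_pairs => /andP[ji /andP[_ km]] /=.
rewrite ltrBrDr addrC -ltrBrDr [RHS]ltrBrDr [in RHS]addrC -[RHS]ltrBrDr.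
exact: xy.
Qed.

(** The code gives the signs by [code_determines_signs]; conversely the signs give the code, and
    those with k = 0 give dominance. *)
Lemma code_region_same_signs {R : realType} {n m : nat} (s : seq nat)
    (x : 'rV[R]_n.+1) :
  code_region R n m s x ->
  code_region R n m s =
  [set y | catalan_complement R n.+1 m y /\ same_signs m x y].
Proof.
move=> [hx dx cx]; apply/seteqP; split=> y /= => [[hy dy cy]|[hy xy]].
  split=> // i j k km.
  rewrite -(ncoord_ord x i) -(ncoord_ord x j) -(ncoord_ord y i) -(ncoord_ord y j).
  apply: (@code_determines_signs _ m n.+1); rewrite ?ltn_ord //.
  - exact/generic_ncoord.
  - exact/decreasing_ncoord.
  - exact/generic_ncoord.
  - exact/decreasing_ncoord.
  move=> a an; have := congr1 (fun t => nth 0%N t a) cx.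
  by rewrite -cy !nth_mkseq.
split=> // [i j ij|].
  by have := xy i j 0%N isT; rewrite !subr_gt0 => <-; apply: dx.
rewrite -cx; apply/eq_in_map => i; rewrite mem_iota => /andP[_ lt_in].
by rewrite (same_signs_code xy).
Qed.

Definition touch_set (n m : nat) (s : seq nat) : {set 'I_n.+1} :=
  [set i : 'I_n.+1 | nth 0%N s i == (m * i)%N].

Lemma card_touch_set (n m : nat) (s : seq nat) : size s = n.+1 ->
  #|touch_set n m s| = touches m 0 s.
Proof.
by move=> ss; rewrite touches_count ss cardsE -sum1_card big_mkcond.
Qed.

(** The case a = 0 is the all-ones direction, parallel to every hyperplane. *)
Definition ray {R : realType} {n : nat} (a : 'I_n) : 'rV[R]_n :=
  \row_j (a <= j)%:R.

Lemma code_region_gap {R : realType} {n m : nat} (s : seq nat)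
    (x : 'rV[R]_n.+1) (a i j : 'I_n.+1) : (0 < m)%N ->
  code_region R n m s x -> a \in touch_set n m s -> (i < a)%N -> (a <= j)%N ->
  m%:R < x ord0 i - x ord0 j.
Proof.
move=> m0 [hx /decreasing_ncoord dx cx]; rewrite inE -cx nth_mkseq //.
case: a => -[//|a] an /=; rewrite (code_fullE m0 dx an) => gap ia aj.
have := decreasing_le dx (ia : (i <= a)%N) (ltnW an).
have := decreasing_le dx aj (ltn_ord j).
rewrite !ncoord_ord; lra.
Qed.

(** The move changes only differences between an index below a and one at or after a. These exceed m
    already and grow further, so no sign test is affected. *)
Lemma code_region_ray {R : realType} {n m : nat} (s : seq nat)
    (x : 'rV[R]_n.+1) (a : 'I_n.+1) (t : R) : (0 < m)%N ->
  code_region R n m s x -> a \in touch_set n m s -> 0 <= t ->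
  code_region R n m s (x - t *: ray a).
Proof.
move=> m0 Dx aS t0; rewrite (code_region_same_signs Dx) /=.
have [hx dx _] := Dx.
have km (k : nat) : (k <= m)%N -> (k%:R : R) <= m%:R by rewrite ler_nat.
split=> [i j ij k|i j k] /[dup] kn /km {}km.
  have := hx i j ij k kn; rewrite /Defs.coord !mxE.
  move=> /eqP xk; apply/eqP.
  have [ai|ia] := leqP a i; have [aj|ja] := leqP a j => /= E.
  - by apply: xk; lra.
  - by have := code_region_gap m0 Dx aS ja ai; have := ler0n R k; lra.
  - by have := code_region_gap m0 Dx aS ia aj; lra.
  - by apply: xk; lra.
rewrite !mxE.
have [ai|ia] := leqP a i; have [aj|ja] := leqP a j => /=.
- by congr (_ < _); lra.
- have := code_region_gap m0 Dx aS ja ai; have := ler0n R k.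
  by move=> ? ?; apply/idP/idP; lra.
- have := code_region_gap m0 Dx aS ia aj.
  by move=> ?; apply/idP/idP; lra.
- by congr (_ < _); lra.
Qed.

Definition ray_mx (R : realType) (n : nat) : 'M[R]_n := \matrix_a ray a.

Lemma ray_mx_unit (R : realType) (n : nat) : ray_mx R n \in unitmx.
Proof.
rewrite -unitmx_tr unitmxE det_trig => [|]; last first.
  apply/is_trig_mxP => i j ij; rewrite !mxE.
  by rewrite leqNgt ij.
by rewrite big1 ?unitr1 // => i _; rewrite !mxE leqnn.
Qed.

Lemma rank_rays {R : realType} {n : nat} (S : {set 'I_n}) :
  \rank (rowsub (fun i : 'I_#|S| => enum_val i) (ray_mx R n)) = #|S|.
Proof.
rewrite rowsubE mxrankMfree ?row_free_unit ?ray_mx_unit //.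
apply/eqP; rewrite -[_ == _]/(row_free _); apply/row_freeP.
(* Selecting the same columns is a right inverse of selecting rows of the identity. *)
exists (colsub (fun i : 'I_#|S| => enum_val i) 1%:M).
rewrite -mxsub_mul mulmx1; apply/matrixP => i j; rewrite !mxE.
by rewrite (inj_eq enum_val_inj).
Qed.

Lemma bounded_ray_eq0 {R : realType} (a b M : R) :
  (forall t, 0 <= t -> `|a - t * b| <= M) -> b = 0.
Proof.
move=> tM; apply/eqP; apply: contraT => b0.
have bp : 0 < `|b| by rewrite normr_gt0.
have M0 : 0 <= M by have := tM 0 (lexx 0); exact: le_trans.
(* For this t the reverse triangle inequality bounds the left side below by M + 1. *)
have := tM ((`|a| + M + 1) / `|b|) _; rewrite divr_ge0 ?addr_ge0 //.
move=> /(_ isT); have := lerB_dist (((`|a| + M + 1) / `|b|) * b) a.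
rewrite [X in X - _]normrM ger0_norm ?divr_ge0 ?addr_ge0 // divfK ?gt_eqF //.
by rewrite distrC => h1 h2; have := le_trans h1 h2; lra.
Qed.

Lemma sqdist_coord {R : realType} {n : nat} (x y : 'rV[R]_n) (r : R) (i : 'I_n) :
  0 <= r -> sqdist R n x y <= r ^+ 2 -> `|x ord0 i - y ord0 i| <= r.
Proof.
move=> r0 xy; rewrite -(ler_pXn2r (n := 2)) ?nnegrE ?normr_ge0 //.
rewrite real_normK ?num_real //; apply: le_trans xy.
rewrite /sqdist (bigD1 i) //= lerDl sumr_ge0 // => j _; exact: sqr_ge0.
Qed.

(** Multiplication by [cokermx B] kills the nearby point y, so the image of [x - t *: v] stays
    bounded as t grows, which forces the image of v to vanish. *)
Lemma near_subspace_ray {R : realType} {n : nat} (B : 'M[R]_n) (x v : 'rV[R]_n)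
    (r : R) : 0 <= r ->
  (forall t, 0 <= t -> exists2 y : 'rV[R]_n, (y <= B)%MS &
     sqdist R n (x - t *: v) y <= r ^+ 2) ->
  (v <= B)%MS.
Proof.
move=> r0 nearB; rewrite submxE; apply/eqP/rowP => c; rewrite [RHS]mxE.
apply: (@bounded_ray_eq0 _ ((x *m cokermx B) ord0 c) _
  (\sum_j r * `|cokermx B j c|)) => t t0.
have [y] := nearB t t0; rewrite submxE => /eqP yB /sqdist_coord d.
have -> : (x *m cokermx B) ord0 c - t * (v *m cokermx B) ord0 c =
    ((x - t *: v - y) *m cokermx B) ord0 c.
  by rewrite !mulmxBl yB subr0 -scalemxAl !mxE.
rewrite mxE; apply: le_trans (ler_norm_sum _ _ _) _; apply: ler_sum => j _.
by rewrite normrM ler_wpM2r // ?normr_ge0 //; have := d j r0; rewrite !mxE.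
Qed.

Lemma code_region_level_ge {R : realType} {n m : nat} (s : seq nat) (k : nat) :
  (0 < m)%N -> code_region R n m s !=set0 ->
  near_subspace R n.+1 (code_region R n m s) k -> (#|touch_set n m s| <= k)%N.
Proof.
move=> m0 [x Dx] [B [r [<- [r0 nearB]]]].
rewrite -(@rank_rays R); apply: mxrankS; apply/row_subP => i.
rewrite row_rowsub rowK; apply: (@near_subspace_ray _ _ B x _ r (ltW r0)).
move=> t t0; have [|y [yB yd]] := nearB (x - t *: ray (enum_val i)).
  by apply: code_region_ray => //; exact: enum_valP.
by exists y.
Qed.

Lemma code_region_near_rays {R : realType} {n m : nat} (s : seq nat) :
  (0 < m)%N -> near_subspace R n.+1 (code_region R n m s) #|touch_set n m s|.
Proof.
move=> m0; set S := touch_set n m s.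
exists <<rowsub (fun i : 'I_#|S| => enum_val i) (ray_mx R n.+1)>>%MS.
(* Each coordinate is off by at most n.+1 omitted jumps of size at most m; summing n.+1 such squares
   stays below the square of this radius. *)
exists (n.+1%:R * (n.+1%:R * m%:R)); split; first by rewrite mxrank_gen rank_rays.
split; first by rewrite !mulr_gt0 ?ltr0n.
move=> x [hx /decreasing_ncoord dx cx].
(* x is the sum of d a *: ray a over all a; keeping only the a in S, where the
   jumps exceed m, gives a point of the span at bounded distance. *)
pose d (a : 'I_n.+1) := if a is Ordinal a'.+1 _ then
   ncoord x a'.+1 - ncoord x a' else ncoord x 0.
have dsum (j : nat) : (j < n.+1)%N ->
    \sum_(a < n.+1) d a * (a <= j)%:R = ncoord x j.
  elim: j => [|j IH] jn.
    rewrite big_ord_recl /= mulr1 big1 ?addr0 // => i _.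
    by rewrite mulr0.
  rewrite -[RHS](subrK (ncoord x j)).
  rewrite (bigD1 (Ordinal jn)) //= leqnn mulr1; congr (_ + _).
  rewrite -(IH (ltnW jn)) [RHS](bigD1 (Ordinal jn)) //= ltnn mulr0 add0r.
  apply: eq_bigr => i; rewrite -val_eqE /= => ij.
  by rewrite [(i <= j.+1)%N]leq_eqVlt (negPf ij) ltnS.
(* Index 0 is always in S, its code being 0, so the unbounded term [d 0] is never omitted. *)
have dsmall a : a \notin S -> `|d a| <= m%:R.
  rewrite inE -cx nth_mkseq //; case: a => -[|a] an /=.
    by rewrite muln0 -leqn0 -[X in (_ <= X)%N](muln0 m) code_leq.
  rewrite (code_fullE m0 dx an) -leNgt => gap.
  have := dx a a.+1 (ltnSn a) an => xa.
  by rewrite ler0_norm ?opprB //; lra.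
exists (\sum_(a in S) d a *: ray a); split.
  rewrite genmxE; apply: summx_sub => a aS; apply: scalemx_sub.
  have -> : ray a = row (enum_rank_in aS a) (rowsub (fun i : 'I_#|S| => enum_val i)
      (ray_mx R n.+1)) by rewrite row_rowsub rowK enum_rankK_in.
  exact: row_sub.
have bound j : (Defs.coord R n.+1 x j -
    Defs.coord R n.+1 (\sum_(a in S) d a *: ray a) j) ^+ 2 <=
    (n.+1%:R * m%:R) ^+ 2.
  rewrite -real_normK ?num_real //.
  rewrite ler_pXn2r ?nnegrE ?mulr_ge0 //.
  rewrite /Defs.coord -ncoord_ord -dsum // summxE (bigID (mem S)) /=.
  rewrite [X in X + _ - _](eq_bigr (fun a => (d a *: ray a) ord0 j)); last first.
    by move=> a _; rewrite !mxE.
  rewrite addrAC subrr add0r.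
  apply: le_trans (ler_norm_sum _ _ _) _.
  apply: (@le_trans _ _ (\sum_(a < n.+1) m%:R)); last first.
    by rewrite sumr_const card_ord mulr_natl.
  rewrite [leRHS](bigID (mem S)) /= -[leLHS]add0r lerD ?sumr_ge0 //.
  apply: ler_sum => a /dsmall; case: leq => //; rewrite ?mulr1 // mulr0 normr0.
  by move=> _; exact: ler0n.
rewrite /sqdist; apply: le_trans (ler_sum _ (fun j _ => bound j)) _.
rewrite sumr_const card_ord -[leLHS]mulr_natl [leRHS]exprMn ler_wpM2r ?sqr_ge0 //.
by rewrite ler_eXnr // ler1n.
Qed.

Lemma has_level_code_region {R : realType} {n m : nat} (s : seq nat) (l : nat) :
  (0 < m)%N -> size s = n.+1 -> code_region R n m s !=set0 ->
  has_level R n.+1 (code_region R n m s) l <-> touches m 0 s = l.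
Proof.
move=> m0 ss Ds; rewrite -(card_touch_set m ss).
have near_l := @code_region_near_rays R n m s m0.
split=> [[/(code_region_level_ge m0 Ds) ge_l le_l]|<-].
  by apply/eqP; rewrite eqn_leq ge_l le_l.
by split=> // k; exact: code_region_level_ge.
Qed.

(** * Permuting the coordinates *)

Lemma col_perm_complement {R : realType} {n m : nat} (sg : {perm 'I_n})
    (x : 'rV[R]_n) :
  catalan_complement R n m x -> catalan_complement R n m (col_perm sg x).
Proof.
move=> hx i j ij k km; rewrite /Defs.coord !mxE; apply: hx => //.
by rewrite (inj_eq perm_inj).
Qed.

Lemma col_permVK {R : realType} {n : nat} (sg : {perm 'I_n}) (x : 'rV[R]_n) :
  col_perm sg (col_perm sg^-1 x) = x.
Proof. by apply/rowP => j; rewrite !mxE permK. Qed.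

Lemma col_permKV {R : realType} {n : nat} (sg : {perm 'I_n}) (x : 'rV[R]_n) :
  col_perm sg^-1 (col_perm sg x) = x.
Proof. by apply/rowP => j; rewrite !mxE permKV. Qed.

Lemma col_perm_same_signs {R : realType} {n m : nat} (sg : {perm 'I_n})
    (x y : 'rV[R]_n) :
  same_signs m (col_perm sg x) (col_perm sg y) <-> same_signs m x y.
Proof.
split=> xy i j k km; last by rewrite !mxE xy.
by have := xy (sg^-1 i)%g (sg^-1 j)%g k km; rewrite !mxE !permKV.
Qed.

(** Sending an index to the number of larger coordinates is a permutation, as the coordinates are
    distinct; its inverse sorts x. *)
Lemma exists_sorting_perm {R : realType} {n : nat} (x : 'rV[R]_n) :
  (forall i j : 'I_n, i != j -> x ord0 i != x ord0 j) ->
  exists sg : {perm 'I_n}, dominant_chamber R n (col_perm sg x).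
Proof.
move=> xinj; case: n x xinj => [|n] x xinj; first by exists 1%g => -[].
pose A (i : 'I_n.+1) := [set j | x ord0 i < x ord0 j]%SET.
have ltA i j : x ord0 i < x ord0 j -> (#|A j| < #|A i|)%N.
  move=> ij; apply/proper_card/properP; split.
    by apply/fintype.subsetP => k; rewrite !inE; exact: lt_trans.
  by exists j; rewrite !inE ?ltxx.
have Abound i : (#|A i| < n.+1)%N.
  rewrite -[X in (_ < X)%N]card_ord -cardsT; apply/proper_card/properP.
  by split; [exact: finset.subsetT | exists i; rewrite !inE ?ltxx].
pose r i := Ordinal (Abound i).
have r_inj : injective r.
  move=> i j /(congr1 val) /= ij; apply/eqP; apply: contraT => /xinj.
  by case: ltgtP => // /ltA; rewrite ij ltnn.
exists (perm r_inj)^-1%g => i j ij; rewrite /Defs.coord !mxE.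
have rE k : val k = #|A ((perm r_inj)^-1%g k)|.
  by rewrite -[in LHS](permKV (perm r_inj) k) permE.
rewrite ltNge le_eqVlt; apply/negP => /predU1P[|/ltA].
  move=> /eqP; apply/negP/xinj; rewrite (inj_eq perm_inj).
  by apply: contraTneq ij => ->; rewrite ltnn.
by rewrite -!rE ltnNge ltnW.
Qed.

(** After sorting, exactly a coordinates are larger than the one at position a, so x alone fixes the
    position of each index. *)
Lemma sorting_perm_unique {R : realType} {n : nat} (x : 'rV[R]_n)
    (sg tau : {perm 'I_n}) :
  dominant_chamber R n (col_perm sg x) ->
  dominant_chamber R n (col_perm tau x) -> sg = tau.
Proof.
have rank (s : {perm 'I_n}) a : dominant_chamber R n (col_perm s x) ->
    #|[set j | x ord0 (s a) < x ord0 j]%SET| = a.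
  move=> ds; have dsE b : (x ord0 (s a) < x ord0 (s b)) = (b < a)%N.
    have [ba|ab|ab] := ltngtP b a.
    - by have := ds b a ba; rewrite /Defs.coord !mxE.
    - by have := ds a b ab; rewrite /Defs.coord !mxE => /ltW; rewrite leNgt => /negPf.
    - by rewrite (ord_inj ab) ltxx.
  rewrite -[RHS]card_ord -sum1_card.
  rewrite (reindex_inj (@perm_inj _ s)) -[RHS]sum1_card.
  rewrite (eq_bigl (fun b : 'I_n => (b < a)%N)) => [|b]; last by rewrite inE dsE.
  by rewrite (big_ord_narrow (ltnW (ltn_ord a))).
move=> dsg dtau; apply/permP => a.
have [b ab] : exists b, sg a = tau b by exists (tau^-1 (sg a))%g; rewrite permKV.
rewrite ab; congr (tau _); apply/ord_inj.
by rewrite -(rank sg a dsg) ab (rank tau b dtau).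
Qed.

(** * Labelling all regions by a sorting permutation and a code *)

Definition labelled_region (R : realType) (n m : nat)
    (p : {perm 'I_n.+1} * seq nat) : set 'rV[R]_n.+1 :=
  [set x | code_region R n m p.2 (col_perm p.1 x)].
Arguments labelled_region : clear implicits.

Lemma labelled_region1 {R : realType} {n m : nat} (s : seq nat) :
  labelled_region R n m (1%g, s) = code_region R n m s.
Proof. by apply/funext => x; rewrite /labelled_region /= col_perm1. Qed.

Lemma labelled_region_component {R : realType} {n m : nat}
    (p : {perm 'I_n.+1} * seq nat) (x : 'rV[R]_n.+1) :
  labelled_region R n m p x ->
  labelled_region R n m p = connected_component (catalan_complement R n.+1 m) x.
Proof.
move=> Dx; have [hx _ _] := Dx.
have {}hx : catalan_complement R n.+1 m x.
  by rewrite -(col_permKV p.1 x); exact: col_perm_complement.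
rewrite connected_component_catalan //; apply/seteqP; split=> y.
  rewrite /labelled_region /= (code_region_same_signs Dx) /=.
  move=> [hy /col_perm_same_signs xy]; split=> //.
  by rewrite -(col_permKV p.1 y); exact: col_perm_complement.
move=> [hy xy]; rewrite /labelled_region /= (code_region_same_signs Dx) /=.
by split; [exact: col_perm_complement | exact/col_perm_same_signs].
Qed.

Lemma code_region_nonempty (R : realType) {n m : nat} (s : seq nat) :
  s \in codes m n.+1 0 0 -> code_region R n m s !=set0.
Proof.
move=> /mem_codesP[ss ps sm].
have [|i lt_in|u [gu du cu]] := @code_surjective R m n.+1 (nth 0%N s).
- move=> i; rewrite -ss => lt_is.
  have := pathP 0%N ps i.+1 lt_is; apply.
- exact: sm.
exists (\row_i u i).
have cE i : (i < n.+1)%N -> ncoord (\row_(i < n.+1) u i) i = u i.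
  by move=> lt_in; rewrite /ncoord mxE inordK.
split.
- by apply/generic_ncoord => i j k lt_in lt_jn; rewrite !cE //; exact: gu.
- apply/decreasing_ncoord => i j ij lt_jn; rewrite !cE ?du //.
  exact: ltn_trans lt_jn.
apply: (@eq_from_nth _ 0%N); rewrite size_mkseq // => i lt_in.
rewrite nth_mkseq // -cu //; apply: eq_code => j ji.
by rewrite cE //; exact: leq_ltn_trans lt_in.
Qed.

Lemma labelled_region_nonempty (R : realType) {n m : nat}
    (p : {perm 'I_n.+1} * seq nat) :
  p.2 \in codes m n.+1 0 0 -> labelled_region R n m p !=set0.
Proof.
move=> /(code_region_nonempty R)[x Dx]; exists (col_perm p.1^-1 x).
by rewrite /labelled_region /= col_permVK.
Qed.

Lemma code_region_exists {R : realType} {n m : nat} (x : 'rV[R]_n.+1) :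
  catalan_complement R n.+1 m x -> dominant_chamber R n.+1 x ->
  exists2 s, s \in codes m n.+1 0 0 & code_region R n m s x.
Proof.
move=> hx dx; exists (mkseq (code m (ncoord x)) n.+1) => //.
apply/mem_codesP; rewrite size_mkseq; split=> // [|j jn]; last first.
  by rewrite nth_mkseq // code_leq.
apply/(pathP 0%N) => i; rewrite size_mkseq => lt_in.
rewrite nth_mkseq //; case: i lt_in => [|i] lt_in //=.
rewrite -/(mkseq _ _) (nth_mkseq _ _ (ltnW lt_in)).
by apply: code_nondecreasing lt_in; exact/decreasing_ncoord.
Qed.

Lemma catalan_regionsE (R : realType) (n m : nat) :
  catalan_regions R n.+1 m =
  labelled_region R n m @` [set p | p.2 \in codes m n.+1 0 0].
Proof.
apply/seteqP; split=> C /=.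
  move=> [x hx ->]; have [i j ij|sg dx] := @exists_sorting_perm R n.+1 x.
    by have := hx i j ij 0%N isT; rewrite subr_eq0.
  have [s sC Dx] := code_region_exists (col_perm_complement sg hx) dx.
  exists (sg, s) => //; exact: labelled_region_component.
move=> [p /(labelled_region_nonempty R)[x Dx] <-].
exists x; last exact: labelled_region_component.
have [hx _ _] := Dx.
by rewrite -(col_permKV p.1 x); exact: col_perm_complement.
Qed.

(** A common point determines both its sorting permutation and the code of its sorted form. *)
Lemma labelled_region_inj (R : realType) (n m : nat) :
  {in [set p | p.2 \in codes m n.+1 0 0] &, injective (labelled_region R n m)}.
Proof.
move=> [sg s] [tau t] /set_mem /= /(labelled_region_nonempty R (p := (sg, s))).
move=> [x Dx] _ E; have Dx' : labelled_region R n m (tau, t) x by rewrite -E.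
have [_ dsg /= <-] := Dx; have [_ dtau /= <-] := Dx'.
have /= -> := sorting_perm_unique dsg dtau.
by [].
Qed.

(** Permuting coordinates is a linear isometry, so it preserves both distances and ranks. *)
Lemma near_subspace_col_perm {R : realType} {n : nat} (sg : {perm 'I_n})
    (X : set 'rV[R]_n) (k : nat) :
  near_subspace R n X k ->
  near_subspace R n [set x | X (col_perm sg x)] k.
Proof.
move=> [B [r [Bk [r0 nearB]]]]; exists (col_perm sg^-1 B), r; split.
  by rewrite col_permE mxrankMfree // row_free_unit unitmx_perm.
split=> // x /nearB [y [yB xy]]; exists (col_perm sg^-1 y); split.
  by rewrite !col_permE submxMr.
apply: le_trans xy; rewrite le_eqVlt; apply/orP; left; apply/eqP.
rewrite /sqdist (reindex_inj (@perm_inj _ sg)); apply: eq_bigr => i _.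
by rewrite /Defs.coord !mxE permK.
Qed.

Lemma has_level_labelled_region {R : realType} {n m : nat}
    (p : {perm 'I_n.+1} * seq nat) (l : nat) :
  (0 < m)%N -> p.2 \in codes m n.+1 0 0 ->
  has_level R n.+1 (labelled_region R n m p) l <-> touches m 0 p.2 = l.
Proof.
case: p => sg s m0 sC; have /mem_codesP[ss _ _] := sC.
rewrite -(has_level_code_region l m0 ss (code_region_nonempty R sC)) [_.2]/=.
have nearE k : near_subspace R n.+1 (labelled_region R n m (sg, s)) k <->
    near_subspace R n.+1 (code_region R n m s) k.
  split; last exact: near_subspace_col_perm.
  move/(near_subspace_col_perm sg^-1); congr (near_subspace _ _ _ _).
  by apply/funext => x; rewrite /labelled_region /= col_permVK.
rewrite /has_level; split=> -[/nearE nl le_l]; split=> // k /nearE; exact: le_l.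
Qed.

Lemma labelled_region_dominant {R : realType} {n m : nat}
    (p : {perm 'I_n.+1} * seq nat) : p.2 \in codes m n.+1 0 0 ->
  labelled_region R n m p `<=` dominant_chamber R n.+1 <-> p.1 = 1%g.
Proof.
case: p => sg s /[dup] sC /(labelled_region_nonempty R (p := (sg, s)))[x Dx].
split=> [|/= -> {x Dx}x]; last by rewrite labelled_region1 => -[].
move=> /(_ x Dx) dx; have [_ dsg _] := Dx.
by apply: sorting_perm_unique dsg _; rewrite col_perm1.
Qed.

(** * Cardinalities of the sets of regions *)

Lemma card_image_seq {T : choiceType} {U : Type} (s : seq T) (f : T -> U) :
  uniq s -> {in s &, injective f} -> f @` [set` s] #= `I_(size s).
Proof.
(* T may be empty, so the default element for [nth] is taken from s when s is nonempty. *)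
move=> us finj; have [sE|[x0 _]] : s = [::] \/ exists x0 : T, True.
  by case: (s) => [|x0 s']; [left | right; exists x0].
  rewrite sE; have -> : [set` ([::] : seq T)] = set0 by apply/seteqP; split.
  by rewrite image_set0 II0.
have -> : f @` [set` s] = (fun i => f (nth x0 s i)) @` `I_(size s).
  apply/seteqP; split=> y /= [].
    by move=> x xs <-; exists (index x s); rewrite /= ?index_mem ?nth_index.
  by move=> i si <-; exists (nth x0 s i) => //=; exact: mem_nth.
apply: inj_card_eq => i j /set_mem /= si /set_mem /= sj /finj E.
by apply/eqP; rewrite -(nth_uniq x0 si sj us) E ?mem_nth.
Qed.

Lemma regions_of_levelE (R : realType) (n m l : nat) : (0 < m)%N ->
  regions_of_level R n.+1 m l =
  labelled_region R n m @`
    [set p | p.2 \in [seq s <- codes m n.+1 0 0 | touches m 0 s == l]].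
Proof.
move=> m0; apply/seteqP; split=> C /=.
  rewrite /regions_of_level /= catalan_regionsE => -[[p /= pC <-]].
  move=> /(has_level_labelled_region l m0 pC) pl.
  by exists p; rewrite // mem_filter pl eqxx.
move=> [p + <-]; rewrite mem_filter => /andP[/eqP pl pC]; split.
  by rewrite catalan_regionsE; exists p.
exact/has_level_labelled_region.
Qed.

Lemma dominant_regions_of_levelE (R : realType) (n m l : nat) : (0 < m)%N ->
  dominant_regions_of_level R n.+1 m l =
  code_region R n m @` [set` [seq s <- codes m n.+1 0 0 | touches m 0 s == l]].
Proof.
move=> m0; rewrite /dominant_regions_of_level regions_of_levelE //.
apply/seteqP; split=> C /=.
  move=> [[[sg s] sl <-]]; have := sl; rewrite /= mem_filter => /andP[_ sC].
  move=> /(labelled_region_dominant (p := (sg, s)) sC) /= ->.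
  by exists s; rewrite // labelled_region1.
move=> [s sl <-]; have := sl; rewrite mem_filter => /andP[_ sC].
rewrite -labelled_region1; split; first by exists (1%g, s).
exact/(labelled_region_dominant (p := (1%g, s)) sC).
Qed.

Unset Implicit Arguments.

Theorem theorem5p1 (R : realType) (m n l : nat) :
  (1 <= m)%N -> (1 <= n)%N -> (1 <= l)%N -> (l <= n)%N ->
  exists re : nat,
    dominant_regions_of_level R n m l #= `I_re /\
    (re%:R : rat) = (m * l)%:R / ((m.+1 * n - l)%N)%:R * ('C(m.+1 * n - l, m * n))%:R /\
    regions_of_level R n m l #= `I_(n`! * re).
Proof.
case: n => // n m0 _ _ ln.
set V := [seq s <- codes m n.+1 0 0 | touches m 0 s == l].
have VC s : s \in V -> s \in codes m n.+1 0 0 by rewrite mem_filter => /andP[].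
have uV : uniq V by rewrite filter_uniq // codes_uniq.
exists (size V); split; [|split].
- rewrite dominant_regions_of_levelE //; apply: card_image_seq => // s t sV tV.
  rewrite -!labelled_region1 => /labelled_region_inj E.
  suff [//] : (1%g : {perm 'I_n.+1}, s) = (1%g, t).
  by apply: E; apply/mem_set; apply: VC.
(* Since l <= n.+1, the denominator is at least m * n.+1 > 0. *)
- have D0 : (m.+1 * n.+1 - l)%:R != 0 :> rat by rewrite pnatr_eq0; nia.
  rewrite mulrAC -natrM; apply: canRL (mulfK D0) _.
  by rewrite -natrM size_codes_touches.
rewrite regions_of_levelE //.
pose W := [seq (sg, s) | sg <- enum {: {perm 'I_n.+1}}, s <- V].
have WE : [set p | p.2 \in V] = [set` W].
  apply/seteqP; split=> -[sg s] /=.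
    by move=> sV; apply/allpairsP; exists (sg, s); rewrite mem_enum.
  by case/allpairsP=> -[? ?] [_ + [_ ->]].
have -> : (n.+1`! * size V)%N = size W.
  by rewrite size_allpairs -cardE -card_Sn.
rewrite -/V WE; apply: card_image_seq.
  by apply: allpairs_uniq; rewrite ?enum_uniq // => -[? ?] [? ?] _ _ [-> ->].
have WV p : p \in W -> p.2 \in codes m n.+1 0 0.
  by case/allpairsP=> -[? ?] [_ /VC + ->].
by move=> p q pW qW; apply: labelled_region_inj; apply/mem_set; exact: WV.
Qed.
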